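(* Let $d\ge2$, $1\le r,p<\infty$, and let $u_0\in\dot{B}^{\frac dp-1}_{p,r}(\mathbb{R}^d)$ be (divergence-free) initial data of the Navier-Stokes problem $u_t-\Delta u=-\mathbb{P}(u\cdot\nabla u)$, $u|_{t=0}=u_0$, and let $T$ be a lifespan corresponding to $u_0$. If $u_0^n\in\dot{B}^{\frac dp-1}_{p,r}(\mathbb{R}^d)$ are other (divergence-free) initial data such that $\|u_0^n-u_0\|_{\dot{B}^{\frac dp-1}_{p,r}}\to0$ as $n\to\infty$, then one can construct a lifespan $T^n$ corresponding to $u_0^n$ such that $$T^n\to T,\qquad n\to\infty.$$
   Context: $\mathbb{P}=I+\nabla(-\Delta)^{-1}\mathrm{div}$ is the Leray projector. Littlewood-Paley operators: fix a radial $\varphi\in C_c^\infty$ with values in $[0,1]$, supported in $\{\frac34\le|\xi|\le\frac83\}$, with $\sum_{j\in\mathbb{Z}}\varphi(2^{-j}\xi)=1$ for $\xi\ne0$, and set $\dot\Delta_j u=\mathcal{F}^{-1}(\varphi(2^{-j}\cdot)\mathcal{F}u)$, $j\in\mathbb{Z}$. The space $\dot{B}^s_{p,r}(\mathbb{R}^d)$ is the set of $u\in\mathcal{S}'_h(\mathbb{R}^d)$ (tempered distributions whose low-frequency cut-offs $\theta(\lambda D)u$ tend to $0$ in $L^\infty$ as $\lambda\to\infty$, for every $\theta\in C_c^\infty$) with $\|u\|_{\dot{B}^s_{p,r}}=\big\|(2^{js}\|\dot\Delta_j u\|_{L^p})_{j\in\mathbb{Z}}\big\|_{\ell^r}<\infty$;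 and $\|f\|_{\widetilde{L}^q_T(\dot{B}^s_{p,r})}=\big\|(2^{js}\|\dot\Delta_j f\|_{L^q([0,T];L^p)})_{j\in\mathbb{Z}}\big\|_{\ell^r}$. Constant $C_1$: a fixed, sufficiently large constant $C_1\ge C$ depending only on $d,p,r$, where $C$ is the constant in the heat estimate $\|u\|_{\widetilde{L}^{q}_T(\dot{B}^{s+2/q}_{p,r})}\le C\big(\|u_0\|_{\dot{B}^s_{p,r}}+\|G\|_{\widetilde{L}^{q_1}_T(\dot{B}^{s+2/q_1-2}_{p,r})}\big)$, $1\le q_1\le q\le\infty$, for $u_t-\Delta u=G$, $u|_{t=0}=u_0$. Lifespan corresponding to an initial datum $u_0$: put $E_0=\|u_0\|_{\dot{B}^{\frac dp-1}_{p,r}}$. A lifespan $T$ corresponding to $u_0$ is the number $$T=\begin{cases}\infty, & E_0\le\frac1{16C_1},\\ \min\{T_0,T_1\}, & E_0\ge\frac{1}{16C_1},\end{cases}\qquad T_0=\frac a4\,\frac1{2^{2j_0}E_0},\quad T_1=\frac{a^2}{4^2}\,\frac1{2^{2j_0}E_0^2},$$ where in the second case $a=\min\{\frac1{16C_1^2E_0},\frac1{4^{4/3}C_1}\}$ and $j_0$ is an integer such that $$\Big[\sum_{|j|\ge j_0}\big(2^{(\frac dp-1)j}\|\dot\Delta_j u_0\|_{L^p}\big)^r\Big]^{1/r}<\frac a4 .$$ A lifespan $T^n$ corresponding to $u_0^n$ is defined in the same way, with $u_0$ replaced by $u_0^n$.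
   Formalization: If E_0 = 1/(16C_1) exactly, where the claim can fail, the formal theorem also assumes that eventually the norm of u_0^n is at most 1/(16C_1) when T is infinite, and at least 1/(16C_1) when T is finite. *)

(* Defs.v *)
From HB Require Import structures.
From mathcomp Require Import all_boot all_order all_algebra.
From mathcomp Require Import all_classical all_reals all_analysis.
From mathcomp Require Import complex.

Set Implicit Arguments.
Unset Strict Implicit.
Unset Printing Implicit Defensive.

Import Order.TTheory GRing.Theory Num.Theory.
Import numFieldNormedType.Exports.

Local Open Scope classical_set_scope.
Local Open Scope ring_scope.
Local Open Scope complex_scope.

(* Lebesgue measure on R^n lives on [n.-tuple R], which carries the product
   sigma-algebra; calculus is done on ['rV[R]_n].  [rv] identifies the two. *)
Section LebesgueRn.
Context {R : realType}.

Definition cons_tuple n (z : measurableTypeR R * n.-tuple (measurableTypeR R))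
  : n.+1.-tuple (measurableTypeR R) := [the n.+1.-tuple _ of z.1 :: z.2].

Lemma measurable_cons_tuple n : measurable_fun setT (@cons_tuple n).
Proof.
by apply: measurable_cons; [exact: measurable_fst | exact: measurable_snd].
Qed.

(* The image of (Lebesgue measure on R) x m under [cons_tuple]; the constant
   below is the library's measure structure on [pushforward], named explicitly
   because it takes the measurability proof as an argument. *)
Definition cons_measure n
    (m : {measure set (n.-tuple (measurableTypeR R)) -> \bar R})
    : {measure set (n.+1.-tuple (measurableTypeR R)) -> \bar R} :=
  measure_function_pushforward__canonical__measure_function_Measure
    (@lebesgue_measure R \x^ m)%E (@measurable_cons_tuple n).

Fixpoint lebesgue_tuple (n : nat)
    : {measure set (n.-tuple (measurableTypeR R)) -> \bar R} :=
  match n with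
  | 0 => dirac ([tuple] : 0.-tuple (measurableTypeR R))
  | m.+1 => cons_measure (lebesgue_tuple m)
  end.

Definition rv n (t : n.-tuple (measurableTypeR R)) : 'rV[R]_n :=
  \row_i (tnth t i : R).

End LebesgueRn.

Section Distributions.
Context {R : realType} {d : nat}.
Local Notation E := 'rV[R]_d.
Local Notation leb := (@lebesgue_tuple R d).

Definition enorm (x : E) : R := Num.sqrt (\sum_i x 0 i ^+ 2).
Definition dotp (x y : E) : R := \sum_i x 0 i * y 0 i.

Definition cis (t : R) : R[i] := cos t +i* sin t.

Definition cint (f : E -> R[i]) : R[i] :=
  Rintegral leb setT (fun t => complex.Re (f (rv t)))
  +i* Rintegral leb setT (fun t => complex.Im (f (rv t))).

Definition cintegrable (f : E -> R[i]) : Prop :=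
  leb.-integrable setT (fun t => (complex.Re (f (rv t)))%:E) /\
  leb.-integrable setT (fun t => (complex.Im (f (rv t)))%:E).

Definition cmeasurable (f : E -> R[i]) : Prop :=
  measurable_fun setT (fun t => complex.Re (f (rv t)) : R) /\
  measurable_fun setT (fun t => complex.Im (f (rv t)) : R).

(* [pderiv [:: i1; ...; ik] f] is the iterated partial derivative
   d_i1 ... d_ik f. *)
Definition pderiv (s : seq 'I_d) (f : E -> R) : E -> R :=
  foldr (fun i g => (fun x => 'D_(delta_mx 0 i) g x)) f s.

Definition smooth (f : E -> R) : Prop :=
  forall s : seq 'I_d, continuous (pderiv s f) /\
    forall (i : 'I_d) (x : E), derivable (pderiv s f) x (delta_mx 0 i).

Definition csmooth (f : E -> R[i]) : Prop :=
  smooth (fun x => complex.Re (f x)) /\ smooth (fun x => complex.Im (f x)).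

Definition cpderiv (s : seq 'I_d) (f : E -> R[i]) : E -> R[i] :=
  fun x => pderiv s (fun y => complex.Re (f y)) x +i* pderiv s (fun y => complex.Im (f y)) x.

Definition laplacian (f : E -> R[i]) : E -> R[i] :=
  fun x => \sum_(i < d) cpderiv [:: i; i] f x.

Definition schwartz (f : E -> R[i]) : Prop :=
  csmooth f /\
  forall (k : nat) (s : seq 'I_d), exists M : R,
    forall x, (1 + enorm x) ^+ k * Normc.normc (cpderiv s f x) <= M.

Definition test_function (f : E -> R[i]) : Prop :=
  csmooth f /\ exists M : R, forall x, f x != 0 -> enorm x <= M.

(* A tempered distribution is a functional on all functions of which only the
   values on Schwartz functions matter: [tempered] and [represents] below look
   at no others, and neither does any operation when its symbol is smooth with
   derivatives of polynomial growth. *)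
Definition dist := (E -> R[i]) -> R[i].

Definition tempered (u : dist) : Prop :=
  (forall (c : R[i]) f g, schwartz f -> schwartz g ->
     u (fun x => c * f x + g x) = c * u f + u g) /\
  (exists (C : R) (N : nat), forall f (M : R), schwartz f ->
     (forall k (s : seq 'I_d) x, (k <= N)%N -> (size s <= N)%N ->
        (1 + enorm x) ^+ k * Normc.normc (cpderiv s f x) <= M) ->
     Normc.normc (u f) <= C * M).

Definition fourier (f : E -> R[i]) : E -> R[i] :=
  fun xi => cint (fun x => cis (- dotp x xi) * f x).

Definition inv_fourier (f : E -> R[i]) : E -> R[i] :=
  fun x => (((2 * pi) ^+ d)^-1)%:C * cint (fun xi => cis (dotp x xi) * f xi).

Definition dist_fourier (u : dist) : dist := fun f => u (fourier f).
Definition dist_inv_fourier (u : dist) : dist := fun f => u (inv_fourier f).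
Definition dist_mul (m : E -> R[i]) (u : dist) : dist :=
  fun f => u (fun x => m x * f x).

(* m(D) u = F^-1 (m F u) *)
Definition multiplier (m : E -> R[i]) (u : dist) : dist :=
  dist_inv_fourier (dist_mul m (dist_fourier u)).

Definition represents (f : E -> R[i]) (u : dist) : Prop :=
  cmeasurable f /\ forall psi, schwartz psi ->
    cintegrable (fun x => f x * psi x) /\ u psi = cint (fun x => f x * psi x).

Definition vdist := 'I_d -> dist.

Definition vtempered (u : vdist) : Prop := forall i, tempered (u i).
Definition vsub (u v : vdist) : vdist := fun i f => u i f - v i f.
Definition vmultiplier (m : E -> R[i]) (u : vdist) : vdist :=
  fun i => multiplier m (u i).

Definition div_free (u : vdist) : Prop :=
  forall psi, schwartz psi -> \sum_(i < d) u i (cpderiv [:: i] psi) = 0.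

Definition vfun_norm (f : 'I_d -> E -> R[i]) (x : E) : R :=
  Num.sqrt (\sum_i Normc.normc (f i x) ^+ 2).

(* The L^p norm of a vector-valued distribution: the L^p norm of the function
   representing it (unique a.e.), and +oo if there is none. *)
Definition Lp_norm (p : \bar R) (u : vdist) : \bar R :=
  ereal_inf [set y | exists f : 'I_d -> E -> R[i],
    (forall i, represents (f i) (u i)) /\
    y = Lnorm leb p (fun t => (vfun_norm f (rv t))%:E)].

End Distributions.

Arguments dist R d : clear implicits.
Arguments vdist R d : clear implicits.

Section Besov.
Context {R : realType} {d : nat}.
Local Notation E := 'rV[R]_d.

Definition lp_cutoff (phi : E -> R) : Prop :=
  [/\ smooth phi,
      forall x y, enorm x = enorm y -> phi x = phi y,
      forall x, 0 <= phi x <= 1,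
      forall x, phi x != 0 -> 3 / 4 <= enorm x <= 8 / 3 &
      forall x, x != 0 ->
        \esum_(j in [set: int]) (phi ((2 : R) ^ (- j) *: x))%:E = 1%E].

Variable phi : E -> R.

Definition lp_block (j : int) (u : vdist R d) : vdist R d :=
  vmultiplier (fun x => (phi ((2 : R) ^ (- j) *: x))%:C) u.

Definition ell_norm (r : R) (P : set int) (a : int -> \bar R) : \bar R :=
  ((\esum_(j in P) (a j `^ r)) `^ r^-1)%E.

Definition besov_term (s p : R) (u : vdist R d) (j : int) : \bar R :=
  ((2 `^ (j%:~R * s))%:E * Lp_norm p%:E (lp_block j u))%E.

Definition besov_norm (s p r : R) (u : vdist R d) : \bar R :=
  ell_norm r setT (besov_term s p u).

(* the space S'_h *)
Definition vanishing_low_freq (u : vdist R d) : Prop :=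
  forall theta : E -> R[i], test_function theta ->
    Lp_norm +oo%E (vmultiplier (fun x => theta (l *: x)) u)
      @[l --> +oo%R] --> 0%E.

Definition besov (s p r : R) (u : vdist R d) : Prop :=
  [/\ vtempered u, vanishing_low_freq u & (besov_norm s p r u < +oo)%E].

Definition time_norm (q : \bar R) (T : R) (g : R -> \bar R) : \bar R :=
  Lnorm (@lebesgue_measure R) q (g \_ `[0, T]).

Definition tilde_norm (q : \bar R) (T s p r : R) (f : R -> vdist R d) : \bar R :=
  ell_norm r setT (fun j => ((2 `^ (j%:~R * s))%:E *
    time_norm q T (fun t => Lp_norm p%:E (lp_block j (f t))))%E).

Definition time_integrable (T : R) (h : R -> R[i]) : Prop :=
  (@lebesgue_measure R).-integrable `[0, T] (fun t => (complex.Re (h t))%:E) /\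
  (@lebesgue_measure R).-integrable `[0, T] (fun t => (complex.Im (h t))%:E).

Definition time_cint (T : R) (h : R -> R[i]) : R[i] :=
  Rintegral (@lebesgue_measure R) `[0, T] (fun t => complex.Re (h t))
  +i* Rintegral (@lebesgue_measure R) `[0, T] (fun t => complex.Im (h t)).

(* u_t - Delta u = G on [0, T], u(0) = u0, in the sense of tempered
   distributions and integrated in time. *)
Definition heat_solution (T : R) (u0 : vdist R d) (G u : R -> vdist R d) : Prop :=
  (forall t, 0 <= t <= T -> vtempered (G t) /\ vtempered (u t)) /\
  forall (i : 'I_d) psi, schwartz psi ->
    [/\ time_integrable T (fun t => u t i psi),
        time_integrable T (fun t => G t i psi) &
        forall t, 0 <= t <= T ->
          u t i psi = u0 i psi +
            time_cint t (fun s => u s i (laplacian psi) + G s i psi)].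

(* 1/q, with 1/oo = 0 *)
Definition recip (q : \bar R) : R := fine (q^-1)%E.

Definition heat_constant (p r C : R) : Prop :=
  0 < C /\
  forall (s T : R) (q1 q : \bar R) (u0 : vdist R d) (G u : R -> vdist R d),
    0 < T -> (1 <= q1)%E -> (q1 <= q)%E ->
    besov s p r u0 -> heat_solution T u0 G u ->
    (tilde_norm q T (s + 2 * recip q) p r u <=
     C%:E * (besov_norm s p r u0 +
             tilde_norm q1 T (s + 2 * recip q1 - 2) p r G))%E.

Definition crit (p : R) : R := d%:R / p - 1.

Definition crit_norm (p r : R) (u : vdist R d) : R :=
  fine (besov_norm (crit p) p r u).

Definition threshold (C1 : R) : R := (16 * C1)^-1.

Definition lifespan_a (C1 E0 : R) : R :=
  Num.min (16 * C1 ^+ 2 * E0)^-1 (4 `^ (4 / 3) * C1)^-1.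

Definition lifespan_T0 (a E0 : R) (j0 : int) : R :=
  a / 4 * (2 ^ (2 * j0) * E0)^-1.

Definition lifespan_T1 (a E0 : R) (j0 : int) : R :=
  a ^+ 2 / 4 ^+ 2 * (2 ^ (2 * j0) * E0 ^+ 2)^-1.

(* [T] is a lifespan of [u0]: a relation, since the second case depends on the
   choice of [j0], and both cases apply when E0 = 1 / (16 C1). *)
Definition lifespan (p r C1 : R) (u0 : vdist R d) (T : \bar R) : Prop :=
  let E0 := crit_norm p r u0 in
  let a := lifespan_a C1 E0 in
  (E0 <= threshold C1 /\ T = +oo%E) \/
  (threshold C1 <= E0 /\ exists j0 : int,
     (ell_norm r [set j : int | (j0 <= `|j|)%R] (besov_term (crit p) p u0)
        < (a / 4)%:E)%E /\
     T = (Num.min (lifespan_T0 a E0 j0) (lifespan_T1 a E0 j0))%:E).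

End Besov.

(* Main.v *)
Require Import Defs.
From mathcomp Require Import all_boot all_order all_algebra.
From mathcomp Require Import all_classical all_reals all_analysis.
From mathcomp Require Import measurable_realfun complex.
From mathcomp Require Import ring lra.
Import Order.TTheory GRing.Theory Num.Theory.
Import numFieldNormedType.Exports.
Local Open Scope classical_set_scope.
Local Open Scope ring_scope.

(** For a fixed index j0, both times T0 and T1 depend on the datum only through
    the critical norm E, and continuously so for E > 0
    ([continuous_lifespan_time]).  The lifespans of the perturbed data can
    therefore be built with the very j0 that produced the given T, once two
    facts are known.

    First, the critical norms converge ([fine_besov_norm_cvg]), by the triangle
    inequality.  The Besov norm is an l^r norm of weighted L^p norms of the
    dyadic blocks, so this takes Minkowski's inequality twice: in L^p, after
    the triangle inequality for the pointwise Euclidean norm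
    ([Lp_norm_le_sub]), and in l^r over the integers ([ell_normD]).  Second,
    the strict inequality between the tail of the l^r norm beyond j0 and a/4
    is stable ([ell_besov_lt_near]): the tail obeys the same triangle
    inequality, is perturbed by at most the full norm of the difference, and
    a depends continuously on E.

    So, from some rank on, the time with index j0 is a lifespan of the
    perturbed datum and tends to T, or else T is infinite and the perturbed
    norms stay at or below the threshold.  Exactly at the threshold the hypothesis
    of the theorem keeps the perturbed norms on the side that T chose.  The
    finitely many remaining data receive arbitrary lifespans, which exist
    because the tails of a convergent series tend to zero
    ([lifespan_exists]).

    Inequalities between norms are stated as N(u) <= N(v) + N(u - v), and
    complemented by N(u - v) = N(v - u), since subtraction is the operation on
    distributions in which the convergence of the data is expressed. *)

(** * Minkowski's inequality and tails in l^r over the integers *)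

Section SequenceNorm.
Context {R : realType}.
Implicit Types (r A B : R) (P : set int) (a b : int -> \bar R).

(** Convexity of the r-th power at x / A and y / B, with weights A / (A + B) and
    B / (A + B).  The constants are such that x^r and y^r replaced by A^r and
    B^r give exactly (A + B)^r, hence Minkowski's inequality upon summation. *)
Lemma powRD_le_weighted {r A B} {x y : R} : 1 <= r -> 0 < A -> 0 < B ->
    0 <= x -> 0 <= y ->
  (x + y) `^ r <= (A + B) `^ r / (A + B) * (A / A `^ r) * x `^ r +
                  (A + B) `^ r / (A + B) * (B / B `^ r) * y `^ r.
Proof.
move=> r1 A0 B0 x0 y0; have S0 : 0 < A + B by rewrite addr_gt0.
have w01 : 0 <= A / (A + B) <= 1.
  by rewrite divr_ge0 ?(ltW A0) ?(ltW S0)//= ler_pdivrMr// mul1r lerDl ltW.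
have [w0 w1] := andP w01.
have : (A / (A + B) * (x / A) + (1 - A / (A + B)) * (y / B)) `^ r <=
    A / (A + B) * (x / A) `^ r + (1 - A / (A + B)) * (y / B) `^ r.
  have := convex_powR r1 (Itv01 w0 w1) (x := x / A) (y := y / B).
  by rewrite !inE/= !in_itv/= !andbT !divr_ge0 ?(ltW A0) ?(ltW B0)//; exact.
have -> : 1 - A / (A + B) = B / (A + B) by field; lra.
have -> : A / (A + B) * (x / A) + B / (A + B) * (y / B) = (x + y) / (A + B).
  by field; rewrite !gt_eqF.
have pV u v : 0 <= u -> 0 < v -> (u / v) `^ r = u `^ r / v `^ r.
  move=> u0 v0; rewrite powRM ?invr_ge0 ?(ltW v0)//; congr (_ * _).
  by rewrite -[v^-1]powR_inv1 ?(ltW v0)// -powRrM mulN1r powRN.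
rewrite !pV ?addr_ge0// ler_pdivrMr ?powR_gt0// => /le_trans; apply.
by rewrite le_eqVlt; apply/orP; left; apply/eqP; field; rewrite !gt_eqF ?powR_gt0.
Qed.

Lemma poweRD_le_weighted {r A B} {x y : \bar R} : 1 <= r -> 0 < A -> 0 < B ->
    (0 <= x)%E -> (0 <= y)%E ->
  ((x + y) `^ r <= ((A + B) `^ r / (A + B) * (A / A `^ r))%:E * x `^ r +
                  ((A + B) `^ r / (A + B) * (B / B `^ r))%:E * y `^ r)%E.
Proof.
move=> r1 A0 B0; have S0 : 0 < A + B by rewrite addr_gt0.
have r0 : r != 0 by rewrite gt_eqF// (lt_le_trans _ r1).
have c0 D : 0 < D -> 0 < (A + B) `^ r / (A + B) * (D / D `^ r).
  by move=> D0; rewrite mulr_gt0// divr_gt0// powR_gt0.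
have ce0 D (z : \bar R) : 0 < D ->
    (0 <= ((A + B) `^ r / (A + B) * (D / D `^ r))%:E * z `^ r)%E.
  by move=> D0; rewrite mule_ge0 ?poweR_ge0// lee_fin ltW// c0.
move: x y => [x| |] [y| |]// x0 y0.
- by rewrite -EFinD !poweR_EFin -!EFinM -EFinD lee_fin powRD_le_weighted.
- by rewrite [in leRHS]poweRyr// gt0_muley ?lte_fin ?c0// addey ?leey.
- by rewrite [in leRHS]poweRyr// gt0_muley ?lte_fin ?c0// addye ?leey.
- by rewrite [in leRHS]poweRyr// !gt0_muley ?lte_fin ?c0// addye ?leey.
Qed.

Lemma esumZ_le {T : choiceType} (P : set T) (c : R) (f : T -> \bar R) :
  0 <= c -> (forall i, 0 <= f i)%E ->
  (\esum_(i in P) (c%:E * f i) <= c%:E * \esum_(i in P) f i)%E.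
Proof.
move=> c0 f0; apply: ge_ereal_sup => _ [X PX <-].
rewrite -ge0_mule_fsumr//; apply: lee_wpmul2l; first by rewrite lee_fin.
by apply: ereal_sup_ubound; exists X.
Qed.

Lemma ell_norm_ge0 r P a : (0 <= ell_norm r P a)%E.
Proof. exact: poweR_ge0. Qed.

Lemma ell_norm_powR r P a : r != 0 ->
  (ell_norm r P a `^ r = \esum_(j in P) (a j `^ r))%E.
Proof.
move=> r0; rewrite /ell_norm -poweRrM mulVf// poweRe1//.
by apply: esum_ge0 => j _; exact: poweR_ge0.
Qed.

Lemma lee_poweR {r} {x y : \bar R} : 0 < r -> (0 <= x)%E -> (0 <= y)%E ->
  (x `^ r <= y `^ r)%E = (x <= y)%E.
Proof.
move=> r0 x0 y0; apply/idP/idP; last first.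
  move=> xy; apply: (gt0_ler_poweR (ltW r0)) xy;
    by rewrite in_itv/= leey andbT.
have K z : (0 <= z)%E -> ((z `^ r) `^ r^-1 = z)%E.
  by move=> z0; rewrite -poweRrM mulfV ?poweRe1// gt_eqF.
move=> xy; rewrite -(K x)// -(K y)//.
have rV0 : 0 <= r^-1 by rewrite invr_ge0 ltW.
apply: (gt0_ler_poweR rV0) xy; by rewrite in_itv/= leey poweR_ge0.
Qed.

Lemma ell_norm_le r P a b : 1 <= r ->
  (forall j, P j -> 0 <= a j)%E -> (forall j, P j -> a j <= b j)%E ->
  (ell_norm r P a <= ell_norm r P b)%E.
Proof.
move=> r1 a0 ab; have r0 : 0 < r by rewrite (lt_le_trans _ r1).
rewrite -(lee_poweR r0) ?ell_norm_ge0// !ell_norm_powR ?gt_eqF//.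
apply: le_esum => j Pj; rewrite lee_poweR ?a0 ?ab//.
exact: le_trans (a0 _ Pj) (ab _ Pj).
Qed.

Lemma ell_norm_subset r P Q a : 1 <= r -> P `<=` Q ->
  (ell_norm r P a <= ell_norm r Q a)%E.
Proof.
move=> r1 PQ; have r0 : 0 < r by rewrite (lt_le_trans _ r1).
rewrite -(lee_poweR r0) ?ell_norm_ge0// !ell_norm_powR ?gt_eqF//.
apply: ge_ereal_sup => _ [X [finX XP] <-]; apply: ereal_sup_ubound.
by exists X => //; split => //; apply: subset_trans PQ.
Qed.

(** Summing the weighted convexity bound requires positive finite A and B;
    the norms themselves may vanish, so A and B exceed them by e / 2. *)
Lemma ell_normD r P a b : 1 <= r ->
  (forall j, 0 <= a j)%E -> (forall j, 0 <= b j)%E ->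
  (ell_norm r P (fun j => a j + b j) <= ell_norm r P a + ell_norm r P b)%E.
Proof.
move=> r1 a0 b0; have r0 : 0 < r by rewrite (lt_le_trans _ r1).
have [->|aoo] := eqVneq (ell_norm r P a) +oo%E.
  by rewrite addye ?leey// gt_eqF// (lt_le_trans _ (ell_norm_ge0 _ _ _)).
have [->|boo] := eqVneq (ell_norm r P b) +oo%E.
  by rewrite addey ?leey// gt_eqF// (lt_le_trans _ (ell_norm_ge0 _ _ _)).
have an : ell_norm r P a \is a fin_num.
  by rewrite ge0_fin_numE ?ell_norm_ge0// ltey.
have bn : ell_norm r P b \is a fin_num.
  by rewrite ge0_fin_numE ?ell_norm_ge0// ltey.
apply/lee_addgt0Pr => e e0.
pose A := fine (ell_norm r P a) + e / 2.
pose B := fine (ell_norm r P b) + e / 2.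
have e20 : 0 < e / 2 by rewrite divr_gt0.
have A0 : 0 < A by rewrite ltr_wpDl// fine_ge0 ?ell_norm_ge0.
have B0 : 0 < B by rewrite ltr_wpDl// fine_ge0 ?ell_norm_ge0.
have S0 : 0 < A + B by rewrite addr_gt0.
have aA : (\esum_(j in P) (a j `^ r) <= (A `^ r)%:E)%E.
  rewrite -ell_norm_powR ?gt_eqF// -poweR_EFin lee_poweR ?ell_norm_ge0//.
    by rewrite -(fineK an) lee_fin lerDl ltW.
  by rewrite lee_fin ltW.
have bB : (\esum_(j in P) (b j `^ r) <= (B `^ r)%:E)%E.
  rewrite -ell_norm_powR ?gt_eqF// -poweR_EFin lee_poweR ?ell_norm_ge0//.
    by rewrite -(fineK bn) lee_fin lerDl ltW.
  by rewrite lee_fin ltW.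
have -> : (ell_norm r P a + ell_norm r P b + e%:E = (A + B)%:E)%E.
  rewrite -(fineK an) -(fineK bn) -!EFinD; congr EFin.
  by rewrite /A /B addrACA -splitr.
rewrite -(lee_poweR r0) ?ell_norm_ge0 ?lee_fin ?(ltW S0)//.
rewrite ell_norm_powR ?gt_eqF//.
apply: (@le_trans _ _ (\esum_(j in P)
   (((A + B) `^ r / (A + B) * (A / A `^ r))%:E * a j `^ r +
   ((A + B) `^ r / (A + B) * (B / B `^ r))%:E * b j `^ r))%E).
  by apply: le_esum => j _; exact: poweRD_le_weighted.
have c0 D : 0 < D -> 0 <= (A + B) `^ r / (A + B) * (D / D `^ r).
  by move=> D0; rewrite mulr_ge0// divr_ge0// ?powR_ge0 ?ltW.
rewrite esumD; first last.
- by move=> j _; rewrite mule_ge0 ?poweR_ge0// lee_fin c0.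
- by move=> j _; rewrite mule_ge0 ?poweR_ge0// lee_fin c0.
apply: (@le_trans _ _ (((A + B) `^ r / (A + B) * (A / A `^ r))%:E * (A `^ r)%:E
  + ((A + B) `^ r / (A + B) * (B / B `^ r))%:E * (B `^ r)%:E)%E).
  apply: leeD.
    apply: le_trans (lee_wpmul2l _ aA); last by rewrite lee_fin c0.
    by apply: esumZ_le; [exact: c0 | move=> j; exact: poweR_ge0].
  apply: le_trans (lee_wpmul2l _ bB); last by rewrite lee_fin c0.
  by apply: esumZ_le; [exact: c0 | move=> j; exact: poweR_ge0].
rewrite poweR_EFin -!EFinM -EFinD lee_fin le_eqVlt; apply/orP; left; apply/eqP.
by field; rewrite !gt_eqF ?powR_gt0.
Qed.

(** A finite set of indices carries all of the sum but less than e^r; beyond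
    its largest absolute value only the remainder is left. *)
Lemma ell_norm_tail r a (e : R) : 1 <= r -> 0 < e ->
  (ell_norm r setT a < +oo)%E ->
  exists j0 : int, (ell_norm r [set j : int | (j0 <= `|j|)%R] a < e%:E)%E.
Proof.
move=> r1 e0 aoo; have r0 : 0 < r by rewrite (lt_le_trans _ r1).
have pe0 : 0 < e `^ r by exact: powR_gt0.
have p0 j : (0 <= a j `^ r)%E by exact: poweR_ge0.
have Sfin : (\esum_(j in setT) (a j `^ r))%E \is a fin_num.
  by rewrite -ell_norm_powR ?gt_eqF// fin_num_poweR// ge0_fin_numE ?ell_norm_ge0.
have [_ [F [finF _] <-] ltF] := ub_ereal_sup_adherent pe0 Sfin.
have [s sF] := (finite_seqP F).1 finF.
(* The sum of the absolute values is a convenient bound for each of them. *)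
exists (\sum_(j <- s) `|j| + 1).
set Q := [set j | _].
have QF : Q `<=` ~` F.
  move=> j Qj Fj; have js : j \in s by move: Fj; rewrite sF.
  move: Qj; rewrite /Q/=; apply/negP; rewrite -ltNge ltzD1.
  by rewrite (big_rem j)//= lerDl sumr_ge0.
have le1 : (\esum_(j in F) (a j `^ r) + \esum_(j in Q) (a j `^ r)
    <= \esum_(j in setT) (a j `^ r))%E.
  rewrite (esumID F setT)// !setTI leeD2l//.
  apply: ge_ereal_sup => _ [X [finX XQ] <-]; apply: ereal_sup_ubound.
  by exists X => //; split => //; apply: subset_trans QF.
rewrite -esum_fset// in ltF.
rewrite ltNge -(lee_poweR r0) ?ell_norm_ge0 ?lee_fin ?(ltW e0)// -ltNge.
rewrite ell_norm_powR ?gt_eqF// poweR_EFin.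
have Ffin : (\esum_(j in F) (a j `^ r))%E \is a fin_num.
  rewrite ge0_fin_numE ?esum_ge0//.
  apply: le_lt_trans (_ : (_ <= \esum_(j in setT) (a j `^ r))%E) _.
    by apply: le_trans le1; rewrite leeDl// esum_ge0.
  by rewrite -ge0_fin_numE ?esum_ge0.
rewrite lteBlDr// in ltF.
by have := le_lt_trans le1 ltF; rewrite lteD2lE.
Qed.

End SequenceNorm.

(** * L^p norms of vector fields *)

Lemma le_Lnorm {d} {T : measurableType d} {R : realType}
    (mu : {measure set T -> \bar R}) {p : R} {f g : T -> R} :
  0 <= p -> measurable_fun setT f -> measurable_fun setT g ->
  (forall x, 0 <= f x <= g x) ->
  (Lnorm mu p%:E (EFin \o f) <= Lnorm mu p%:E (EFin \o g))%E.
Proof.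
move=> p0 mf mg fg; rewrite unlock.
have int0 (h : T -> R) : (0 <= \int[mu]_x (`|(EFin \o h) x| `^ p))%E.
  by apply: integral_ge0 => x _; exact: poweR_ge0.
have pV0 : 0 <= p^-1 by rewrite invr_ge0.
apply: (gt0_ler_poweR pV0); rewrite ?in_itv/= ?leey ?andbT ?int0//.
have mp (h : T -> R) : measurable_fun setT h ->
    measurable_fun setT (fun x => (`|(EFin \o h) x| `^ p)%E).
  move=> mh; apply: (measurableT_comp (measurable_poweR p)).
  by apply: measurableT_comp => //; exact/measurable_EFinP.
apply: ge0_le_integral => //; [exact: mp|exact: mp|].
move=> x _ /=; have /andP[f0 fgx] := fg x.
have g0 := le_trans f0 fgx.
by rewrite !ger0_norm// lee_fin ge0_ler_powR// nnegrE.
Qed.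

Section VectorNorm.
Context {R : realType} {d : nat}.
Implicit Types (f g : 'I_d -> 'rV[R]_d -> R[i]).

(** Lagrange's identity: twice the defect is a double sum of squares. *)
Lemma cauchy_schwarz_sum {I : finType} (x y : I -> R) :
  (\sum_i x i * y i) ^+ 2 <= (\sum_i x i ^+ 2) * (\sum_i y i ^+ 2).
Proof.
rewrite -subr_ge0.
have : 0 <= \sum_i \sum_j (x i * y j - x j * y i) ^+ 2.
  by apply: sumr_ge0 => i _; apply: sumr_ge0 => j _; exact: sqr_ge0.
suff -> : \sum_i \sum_j (x i * y j - x j * y i) ^+ 2 =
  2 * ((\sum_i x i ^+ 2) * (\sum_i y i ^+ 2) - (\sum_i x i * y i) ^+ 2).
  by rewrite pmulr_rge0.
have E i j : (x i * y j - x j * y i) ^+ 2 =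
  x i ^+ 2 * y j ^+ 2 + y i ^+ 2 * x j ^+ 2 - 2 * (x i * y i * (x j * y j)).
  by ring.
under eq_bigr => i _ do under eq_bigr => j _ do rewrite E.
under eq_bigr => i _ do rewrite !big_split/= sumrN -!mulr_sumr.
rewrite !big_split/= sumrN -!mulr_sumr -!mulr_suml.
by ring.
Qed.

Lemma sqrt_sum_sqrD {I : finType} (x y : I -> R) :
  Num.sqrt (\sum_i (x i + y i) ^+ 2) <=
  Num.sqrt (\sum_i x i ^+ 2) + Num.sqrt (\sum_i y i ^+ 2).
Proof.
have x0 : 0 <= \sum_i x i ^+ 2 by apply: sumr_ge0 => i _; exact: sqr_ge0.
have y0 : 0 <= \sum_i y i ^+ 2 by apply: sumr_ge0 => i _; exact: sqr_ge0.
rewrite -[leRHS]ger0_norm ?addr_ge0 ?sqrtr_ge0// -sqrtr_sqr ler_wsqrtr//.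
rewrite sqrrD !sqr_sqrtr// -sqrtrM//.
under eq_bigr do rewrite sqrrD.
rewrite !big_split/= lerD2r lerD2l.
rewrite -mulr2n lerMn2r/=.
rewrite (le_trans (ler_norm _))// -sqrtr_sqr ler_wsqrtr//.
exact: cauchy_schwarz_sum.
Qed.

Lemma normc_ge0 (z : R[i]) : 0 <= Normc.normc z.
Proof. by case: z => a b; exact: sqrtr_ge0. Qed.

Lemma vfun_norm_ge0 f x : 0 <= vfun_norm f x.
Proof. exact: sqrtr_ge0. Qed.

Lemma vfun_normN f x : vfun_norm (fun i y => - f i y) x = vfun_norm f x.
Proof.
by rewrite /vfun_norm; congr Num.sqrt; apply: eq_bigr => i _; rewrite normcN.
Qed.

Lemma vfun_normD f g x :
  vfun_norm (fun i y => f i y + g i y) x <= vfun_norm f x + vfun_norm g x.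
Proof.
have := sqrt_sum_sqrD (fun i => Normc.normc (f i x)) (fun i => Normc.normc (g i x)).
apply: le_trans; rewrite ler_wsqrtr//.
apply: ler_sum => i _; rewrite lerXn2r ?nnegrE ?addr_ge0 ?normc_ge0//.
exact: le_normcD.
Qed.

Lemma measurable_vfun_norm {f} : (forall i, cmeasurable (f i)) ->
  measurable_fun setT (fun t => vfun_norm f (rv t) : R).
Proof.
have msqrt : measurable_fun setT (Num.sqrt : R -> R).
  by apply: continuous_measurable_fun; exact: sqrt_continuous.
move=> mf; apply: (measurableT_comp msqrt).
apply: measurable_sum => i; apply: measurable_funX.
have [mRe mIm] := mf i.
have -> : (fun t => Normc.normc (f i (rv t))) = (fun t =>
    Num.sqrt (complex.Re (f i (rv t)) ^+ 2 + complex.Im (f i (rv t)) ^+ 2)).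
  by apply/funext => t; case: (f i (rv t)).
apply: (measurableT_comp msqrt).
by apply: measurable_funD; exact: measurable_funX.
Qed.

End VectorNorm.

(** * L^p norms of vector-valued distributions *)

Section LpNorm.
Context {R : realType} {d : nat}.
Implicit Types (u v : vdist R d) (f g : 'rV[R]_d -> R[i]).

Lemma cintegrableD {f g} : cintegrable f -> cintegrable g ->
  cintegrable (fun x => f x + g x) /\
  cint (fun x => f x + g x) = cint f + cint g.
Proof.
move=> [fRe fIm] [gRe gIm].
have ReD z w : complex.Re (z + w) = complex.Re z + complex.Re w :> R.
  by case: z; case: w.
have ImD z w : complex.Im (z + w) = complex.Im z + complex.Im w :> R.
  by case: z; case: w.
split; first split.
- under eq_fun do rewrite ReD EFinD; exact: integrableD.
- under eq_fun do rewrite ImD EFinD; exact: integrableD.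
rewrite /cint.
under eq_Rintegral do rewrite ReD.
under [X in (_ +i* X)%C]eq_Rintegral do rewrite ImD.
by rewrite !RintegralD.
Qed.

Lemma cintegrableN {f} : cintegrable f ->
  cintegrable (fun x => - f x) /\ cint (fun x => - f x) = - cint f.
Proof.
move=> [fRe fIm].
have ReN z : complex.Re (- z) = -1 * complex.Re z :> R.
  by case: z => a b; rewrite mulN1r.
have ImN z : complex.Im (- z) = -1 * complex.Im z :> R.
  by case: z => a b; rewrite mulN1r.
split; first split.
- under eq_fun do rewrite ReN EFinM; exact: integrableZl.
- under eq_fun do rewrite ImN EFinM; exact: integrableZl.
rewrite /cint.
under eq_Rintegral do rewrite ReN.
under [X in (_ +i* X)%C]eq_Rintegral do rewrite ImN.
by rewrite !RintegralZl// !mulN1r.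
Qed.

Lemma representsD {f g} {a b : dist R d} : represents f a -> represents g b ->
  represents (fun x => f x + g x) (fun psi => a psi + b psi).
Proof.
move=> [[fRe fIm] fa] [[gRe gIm] gb]; split.
  split.
    rewrite (_ : (fun t => _) = (fun t => complex.Re (f (rv t)) + complex.Re (g (rv t)))).
      exact: measurable_funD.
    by apply/funext => t; case: (f _); case: (g _).
  rewrite (_ : (fun t => _) = (fun t => complex.Im (f (rv t)) + complex.Im (g (rv t)))).
    exact: measurable_funD.
  by apply/funext => t; case: (f _); case: (g _).
move=> psi spsi; have [fi ->] := fa _ spsi; have [gi ->] := gb _ spsi.
have -> : (fun x => (f x + g x) * psi x) = (fun x => f x * psi x + g x * psi x).
  by apply/funext => x; rewrite mulrDl.
by have [? ->] := cintegrableD fi gi.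
Qed.

Lemma representsN {f} {a : dist R d} : represents f a ->
  represents (fun x => - f x) (fun psi => - a psi).
Proof.
move=> [[fRe fIm] fa]; split.
  split.
    rewrite (_ : (fun t => _) = (fun t => - complex.Re (f (rv t)))).
      by apply: measurableT_comp.
    by apply/funext => t; case: (f _).
  rewrite (_ : (fun t => _) = (fun t => - complex.Im (f (rv t)))).
    by apply: measurableT_comp.
  by apply/funext => t; case: (f _).
move=> psi spsi; have [fi ->] := fa _ spsi.
have -> : (fun x => - f x * psi x) = (fun x => - (f x * psi x)).
  by apply/funext => x; rewrite mulNr.
by have [? ->] := cintegrableN fi.
Qed.

Lemma Lp_norm_ge0 (p : \bar R) u : (0 <= Lp_norm p u)%E.
Proof. by apply: le_ereal_inf_tmp => _ [f [_ ->]]; exact: Lnorm_ge0. Qed.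

Lemma Lp_norm_subC (p : \bar R) u v : Lp_norm p (vsub u v) = Lp_norm p (vsub v u).
Proof.
suff le : forall a b : vdist R d, (Lp_norm p (vsub a b) <= Lp_norm p (vsub b a))%E.
  by apply/eqP; rewrite eq_le !le.
move=> a b.
rewrite [leRHS]/Lp_norm; apply: le_ereal_inf_tmp => _ [f [fr ->]].
apply: ereal_inf_lbound; exists (fun i x => - f i x); split.
  move=> i; have := representsN (fr i); congr represents.
  by apply/funext => psi; rewrite opprB.
by congr Lnorm; apply/funext => t; rewrite vfun_normN.
Qed.

(** Near-optimal representatives f of v and g of u - v give the representative
    f + g of u, so Minkowski's inequality for functions passes to the infima. *)
Lemma Lp_norm_le_sub (p : R) u v : 1 <= p ->
  (Lp_norm p%:E u <= Lp_norm p%:E v + Lp_norm p%:E (vsub u v))%E.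
Proof.
move=> p1.
have [->|voo] := eqVneq (Lp_norm p%:E v) +oo%E.
  by rewrite addye ?leey// gt_eqF// (lt_le_trans _ (Lp_norm_ge0 _ _)).
have [->|woo] := eqVneq (Lp_norm p%:E (vsub u v)) +oo%E.
  by rewrite addey ?leey// gt_eqF// (lt_le_trans _ (Lp_norm_ge0 _ _)).
apply/lee_addgt0Pr => e e0; have e20 : 0 < e / 2 by rewrite divr_gt0.
have vfin : Lp_norm p%:E v \is a fin_num.
  by rewrite ge0_fin_numE ?Lp_norm_ge0// ltey.
have wfin : Lp_norm p%:E (vsub u v) \is a fin_num.
  by rewrite ge0_fin_numE ?Lp_norm_ge0// ltey.
have [_ [f [fr ->]] ltf] := lb_ereal_inf_adherent e20 vfin.
have [_ [g [gr ->]] ltg] := lb_ereal_inf_adherent e20 wfin.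
rewrite [e]splitr EFinD addeACA; apply: le_trans (ltW (lteD ltf ltg)).
have mf := measurable_vfun_norm (fun i => (fr i).1).
have mg := measurable_vfun_norm (fun i => (gr i).1).
have := minkowski_EFin (@lebesgue_tuple R d) mf mg p1; apply: le_trans.
apply: (@le_trans _ _ (Lnorm (@lebesgue_tuple R d) p%:E
    (fun t => (vfun_norm (fun i x => f i x + g i x) (rv t))%:E))).
  apply: ereal_inf_lbound; exists (fun i x => f i x + g i x); split=> // i.
  have := representsD (fr i) (gr i); congr represents.
  by apply/funext => psi; rewrite /vsub addrC subrK.
apply: le_Lnorm; first exact: le_trans p1.
- by apply: measurable_vfun_norm => i; exact: (representsD (fr i) (gr i)).1.
- exact: measurable_funD.
- by move=> t; rewrite vfun_norm_ge0/= vfun_normD.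
Qed.

End LpNorm.

(** * Stability of Besov norms and of their tails *)

Section BesovNorm.
Context {R : realType} {d : nat}.
Variable phi : 'rV[R]_d -> R.
Implicit Types (u v : vdist R d) (s p r : R) (P : set int).

Lemma besov_term_ge0 s p u j : (0 <= besov_term phi s p u j)%E.
Proof. by rewrite mule_ge0 ?Lp_norm_ge0// lee_fin powR_ge0. Qed.

Lemma besov_term_le_sub s p u v j : 1 <= p ->
  (besov_term phi s p u j <=
     besov_term phi s p v j + besov_term phi s p (vsub u v) j)%E.
Proof.
move=> p1; rewrite /besov_term -ge0_muleDr ?Lp_norm_ge0//.
apply: lee_wpmul2l; first by rewrite lee_fin powR_ge0.
exact: Lp_norm_le_sub.
Qed.

(** The dyadic blocks commute with subtraction by definition: a Fourier
    multiplier acts by precomposition on the test function. *)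
Lemma besov_term_subC s p u v :
  besov_term phi s p (vsub u v) = besov_term phi s p (vsub v u).
Proof.
apply/funext => j; congr (_ * _)%E.
exact: (Lp_norm_subC _ (lp_block phi j u) (lp_block phi j v)).
Qed.

Lemma ell_besov_le_sub r P s p u v : 1 <= r -> 1 <= p ->
  (ell_norm r P (besov_term phi s p u) <=
     ell_norm r P (besov_term phi s p v) +
     ell_norm r P (besov_term phi s p (vsub u v)))%E.
Proof.
move=> r1 p1.
apply: (@le_trans _ _ (ell_norm r P (fun j =>
    besov_term phi s p v j + besov_term phi s p (vsub u v) j))%E).
  by apply: ell_norm_le => // j _; [exact: besov_term_ge0|
    exact: besov_term_le_sub].
by apply: ell_normD => // j; exact: besov_term_ge0.
Qed.

Lemma besov_norm_ge0 s p r u : (0 <= besov_norm phi s p r u)%E.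
Proof. exact: ell_norm_ge0. Qed.

(** The convergence of the norm of the difference to 0 includes that it is
    eventually finite, which makes the real-valued squeeze possible. *)
Lemma fine_besov_norm_cvg s p r u (un : nat -> vdist R d) : 1 <= r -> 1 <= p ->
  (besov_norm phi s p r u < +oo)%E ->
  (forall n, besov_norm phi s p r (un n) < +oo)%E ->
  besov_norm phi s p r (vsub (un n) u) @[n --> \oo] --> 0%E ->
  fine (besov_norm phi s p r (un n)) @[n --> \oo] -->
    fine (besov_norm phi s p r u).
Proof.
move=> r1 p1 uoo unoo /fine_cvgP [Dfin Dcvg].
pose E0 := fine (besov_norm phi s p r u).
have ufin : besov_norm phi s p r u \is a fin_num.
  by rewrite ge0_fin_numE ?besov_norm_ge0.
have unfin n : besov_norm phi s p r (un n) \is a fin_num.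
  by rewrite ge0_fin_numE ?besov_norm_ge0.
apply: (@squeeze_cvgr _ _ _ _
  (fun n => E0 - fine (besov_norm phi s p r (vsub (un n) u)))
  (fun n => E0 + fine (besov_norm phi s p r (vsub (un n) u)))).
- apply: filterS Dfin => n Dn; rewrite lerBlDr -!lee_fin !EFinD !fineK//.
  rewrite ell_besov_le_sub// andbT.
  by rewrite /besov_norm besov_term_subC ell_besov_le_sub.
- by rewrite -[X in _ --> X]subr0; apply: cvgB => //; exact: cvg_cst.
- by rewrite -[X in _ --> X]addr0; apply: cvgD => //; exact: cvg_cst.
Qed.

(** Stability of the condition that selects j0: on any set P of frequencies the
    norm moves by at most the full norm of the difference, and the strict gap
    below b absorbs this together with the variation of the bound. *)
Lemma ell_besov_lt_near s p r P u (un : nat -> vdist R d) (b : R)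
    (bn : nat -> R) : 1 <= r -> 1 <= p ->
  besov_norm phi s p r (vsub (un n) u) @[n --> \oo] --> 0%E ->
  bn n @[n --> \oo] --> b ->
  (ell_norm r P (besov_term phi s p u) < b%:E)%E ->
  \forall n \near \oo, (ell_norm r P (besov_term phi s p (un n)) < (bn n)%:E)%E.
Proof.
move=> r1 p1 /fine_cvgP [Dfin Dcvg] bcvg ub.
have ufin : ell_norm r P (besov_term phi s p u) \is a fin_num.
  by rewrite ge0_fin_numE ?ell_norm_ge0// (lt_trans ub)// ltry.
pose t := fine (ell_norm r P (besov_term phi s p u)).
have tb : t < b by rewrite -lte_fin fineK.
have gap : bn n - fine (besov_norm phi s p r (vsub (un n) u)) @[n --> \oo] --> b.
  by rewrite -[X in _ --> X]subr0; apply: cvgB.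
apply: filterS2 Dfin (cvgr_gt _ gap _ tb) => n Dn.
rewrite ltrBrDr -lte_fin EFinD !fineK//.
apply: le_lt_trans; apply: le_trans (ell_besov_le_sub _ _ _ _ _ u r1 p1) _.
by rewrite leeD2l// ell_norm_subset.
Qed.

End BesovNorm.

(** * Lifespans *)

Section Lifespan.
Context {R : realType}.

Lemma continuous_lifespan_a (C1 E : R) : 0 < C1 -> 0 < E ->
  {for E, continuous (lifespan_a C1)}.
Proof.
move=> C10 E0; apply: continuous_min; last exact: cvg_cst.
apply: cvgV; first by rewrite gt_eqF// !mulr_gt0// exprn_gt0.
by apply: cvgM; [exact: cvg_cst|exact: cvg_id].
Qed.

Lemma lifespan_a_gt0 (C1 E : R) : 0 < C1 -> 0 < E -> 0 < lifespan_a C1 E.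
Proof.
move=> C10 E0; rewrite lt_min !invr_gt0.
by rewrite !mulr_gt0// ?exprn_gt0// powR_gt0.
Qed.

Lemma continuous_lifespan_time (C1 E : R) (j0 : int) : 0 < C1 -> 0 < E ->
  {for E, continuous (fun x => Num.min (lifespan_T0 (lifespan_a C1 x) x j0)
                                       (lifespan_T1 (lifespan_a C1 x) x j0))}.
Proof.
move=> C10 E0; have a_cont := continuous_lifespan_a C1 E C10 E0.
have two0 : 0 < (2 : R) ^ (2 * j0) by exact: exprz_gt0.
apply: continuous_min.
- apply: cvgM; first by apply: cvgM => //; exact: cvg_cst.
  apply: cvgV; first by rewrite gt_eqF// mulr_gt0.
  by apply: cvgM; [exact: cvg_cst|exact: cvg_id].
- apply: cvgM.
    by apply: cvgM; [rewrite expr2; exact: cvgM|exact: cvg_cst].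
  apply: cvgV; first by rewrite gt_eqF// mulr_gt0// exprn_gt0.
  by apply: cvgM; [exact: cvg_cst|rewrite expr2; apply: cvgM; exact: cvg_id].
Qed.

Context {d : nat}.
Variable phi : 'rV[R]_d -> R.

Lemma lifespan_exists (p r C1 : R) (u : vdist R d) : 1 <= r -> 0 < C1 ->
  besov phi (crit (d := d) p) p r u -> exists T, lifespan phi p r C1 u T.
Proof.
move=> r1 C10 [_ _ uoo].
have [Ele|Egt] := leP (crit_norm phi p r u) (threshold C1).
  by exists +oo%E; left.
have E0 : 0 < crit_norm phi p r u.
  by apply: lt_trans Egt; rewrite invr_gt0 mulr_gt0.
have a0 : 0 < lifespan_a C1 (crit_norm phi p r u) / 4.
  by rewrite divr_gt0// lifespan_a_gt0.
have [j0 j0P] := ell_norm_tail _ _ _ r1 a0 uoo.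
by eexists; right; split; [exact: ltW|exists j0; split].
Qed.

End Lifespan.

(** Only a tail of the sequence matters for the limit, so a candidate that is
    admissible from some rank on can be completed arbitrarily below that
    rank. *)
Lemma eventual_selection {R : realType} {Q : nat -> \bar R -> Prop}
    {c : nat -> \bar R} {l : \bar R} :
  (forall n, exists y, Q n y) -> (\forall n \near \oo, Q n (c n)) ->
  c n @[n --> \oo] --> l ->
  exists y : nat -> \bar R, (forall n, Q n (y n)) /\ y n @[n --> \oo] --> l.
Proof.
move=> /choice[y0 y0P] cQ cl.
exists (fun n => if asbool (Q n (c n)) then c n else y0 n); split.
  by move=> n; case: asboolP.
apply: cvg_trans cl; apply: near_eq_cvg.
by apply: filterS cQ => n Qn; rewrite asboolT.
Qed.

Theorem lemma3p2 (R : realType) (d : nat) (p r : R)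
    (hd : (2 <= d)%N) (hp : 1 <= p) (hr : 1 <= r)
    (phi : 'rV[R]_d -> R) (hphi : lp_cutoff phi)
    (C C1 : R) (hC : heat_constant phi p r C) (hC1 : C <= C1)
    (u0 : vdist R d) (hu0 : besov phi (crit (d := d) p) p r u0)
    (hdiv : div_free u0)
    (T : \bar R) (hT : lifespan phi p r C1 u0 T)
    (u0n : nat -> vdist R d)
    (hu0n : forall n, besov phi (crit (d := d) p) p r (u0n n))
    (hdivn : forall n, div_free (u0n n))
    (hcvg : besov_norm phi (crit (d := d) p) p r (vsub (u0n n) u0)
              @[n --> \oo] --> 0%E)
    (hthr : crit_norm phi p r u0 = threshold C1 ->
       \forall n \near \oo,
         if T == +oo%E then crit_norm phi p r (u0n n) <= threshold C1
         else threshold C1 <= crit_norm phi p r (u0n n)) :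
  exists Tn : nat -> \bar R,
    (forall n, lifespan phi p r C1 (u0n n) (Tn n)) /\
    Tn n @[n --> \oo] --> T.
Proof.
have [C0 _] := hC; have C10 : 0 < C1 := lt_le_trans C0 hC1.
have [_ _ u0oo] := hu0.
have unoo n : (besov_norm phi (crit (d := d) p) p r (u0n n) < +oo)%E.
  by have [] := hu0n n.
have thr0 : 0 < threshold C1 by rewrite invr_gt0 mulr_gt0.
have Ecvg : crit_norm phi p r (u0n n) @[n --> \oo] --> crit_norm phi p r u0.
  exact: fine_besov_norm_cvg.
have ex n := lifespan_exists phi p r C1 (u0n n) hr C10 (hu0n n).
case: hT => [[Ele Teq]|[Ege [j0 [tail Teq]]]].
(* Infinite T: the perturbed norms stay at or below the threshold. *)
- apply: (eventual_selection (c := fun=> +oo%E) ex); last first.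
    by rewrite Teq; exact: cvg_cst.
  suff : \forall n \near \oo, crit_norm phi p r (u0n n) <= threshold C1.
    by apply: filterS => n; left.
  move: Ele; rewrite le_eqVlt => /predU1P[Eeq|Elt].
    by have := hthr Eeq; rewrite Teq eqxx.
  by apply: filterS (cvgr_lt _ Ecvg _ Elt) => n /ltW.
(* Finite T: its index j0 is kept for all perturbed data. *)
have E0 : 0 < crit_norm phi p r u0 := lt_le_trans thr0 Ege.
pose Tc (E : R) := Num.min (lifespan_T0 (lifespan_a C1 E) E j0)
                           (lifespan_T1 (lifespan_a C1 E) E j0).
have Tcvg : Tc (crit_norm phi p r (u0n n)) @[n --> \oo] --> Tc (crit_norm phi p r u0).
  by apply: continuous_cvg Ecvg; exact: continuous_lifespan_time.
apply: (eventual_selection (c := fun n => (Tc (crit_norm phi p r (u0n n)))%:E) ex).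
  have thr_near : \forall n \near \oo, threshold C1 <= crit_norm phi p r (u0n n).
    move: Ege; rewrite le_eqVlt => /predU1P[Eeq|Elt].
      by have := hthr (esym Eeq); rewrite Teq.
    by apply: filterS (cvgr_gt _ Ecvg _ Elt) => n /ltW.
  have acvg : lifespan_a C1 (crit_norm phi p r (u0n n)) / 4 @[n --> \oo] -->
      lifespan_a C1 (crit_norm phi p r u0) / 4.
    apply: cvgM; last exact: cvg_cst.
    by apply: continuous_cvg Ecvg; exact: continuous_lifespan_a.
  have tail_near := ell_besov_lt_near phi _ _ _ _ _ _ _ _ hr hp hcvg acvg tail.
  apply: filterS2 thr_near tail_near => n thrn tailn.
  by right; split=> //; exists j0.
by rewrite Teq; apply: cvg_EFin; [exact: nearW|exact: Tcvg].
Qed.
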